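(* For any $\alpha>0$ and $\delta\in(0,1)$, the following algorithm for the Partially Identifiable Best Arm Identification problem is $(\alpha,\delta)$-PAC: sample each arm $i\in[k]$ exactly $n_{\alpha/2,\delta/k}$ times, produce from these samples the estimate $\hat p_i$ given by the estimator for the problem, and output $\hat I\in\arg\max_{i\in[k]}\hat p_i$. Its sample complexity is $O(k\,n_{\alpha/2,\delta/k})=O\left(\frac{k}{\alpha^2}\log\frac k\delta\right)$.
   Context: Partially Identifiable Best Arm Identification (PIBAI). There are $k\ge2$ arms, $[k]=\{1,\dots,k\}$. For each arm $i$ there is a family of distributions $\{D_i(p_i,G)\}_{G\in\mathcal{G}}$, where $p_i\in\mathbb{R}$ is the (unknown) quality of arm $i$ and $G$ is a nuisance parameter in an abstract space $\mathcal{G}$. Let $i^*=\arg\max_{i}p_i$. In each iteration $t$ an algorithm chooses an arm $I_t$ and receives a sample from $D_{I_t}(p_{I_t},G_t)$ for some unknown, possibly varying $G_t\in\mathcal{G}$; after finitely many iterations it outputs an arm $\hat I$. Its sample complexity is the number of samples used. There are non-negative numbers $U_1,\dots,U_k$ (unavoidable biases) such that (i) even from infinitely many independent samples $X_t\sim D_i(p_i,G_t)$, $p_i$ cannot be estimated more precisely than the region $[p_i-U_i,p_i+U_i]$; and (ii) there is an estimator that, for any $\alpha>0$ and $\delta\in(0,1)$, uses $n_{\alpha,\delta}=O(\alpha^{-2}\log\frac1\delta)$ samples of arm $i$ to output an estimate $\hat p_i$ with $$\mathbb{P}\big(\hat p_i\in[p_i-(U_i+\alpha),\,p_i+(U_i+\alpha)]\big)\ge1-\delta.$$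 The effective gaps are $\tilde\Delta_i=(p_{i^*}-U_{i^*})-(p_i+U_i)$; it is assumed throughout that $\tilde\Delta_i>0$ for each $i\ne i^*$. Arm $i$ is $\alpha$-suboptimal if $\tilde\Delta_i\le\alpha$. An algorithm is $(\alpha,\delta)$-PAC if its output satisfies $\mathbb{P}(\tilde\Delta_{\hat I}\le\alpha)\ge1-\delta$. *)

(* Defs.v *)
From HB Require Import structures.
From mathcomp Require Import all_boot all_order all_algebra.
From mathcomp Require Import all_classical all_reals all_analysis.

Set Implicit Arguments.
Unset Strict Implicit.
Unset Printing Implicit Defensive.

Import Order.TTheory GRing.Theory Num.Theory.
Import numFieldNormedType.Exports.

Local Open Scope classical_set_scope.
Local Open Scope ring_scope.

Definition independent_systems (R : realType) (d : measure_display)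
    (T : measurableType d) (P : probability T R) (J : eqType)
    (F : J -> set_system T) : Prop :=
  forall (s : seq J) (B : J -> set T), uniq s ->
    (forall j, j \in s -> F j (B j)) ->
    P (\bigcap_(j in [set` s]) B j) = (\prod_(j <- s) P (B j))%E.

Definition independent_samples (R : realType) (d dX : measure_display)
    (T : measurableType d) (X : measurableType dX) (P : probability T R)
    (J : eqType) (mu : J -> probability X R) (Y : J -> {RV P >-> X}) : Prop :=
  (forall j (B : set X), measurable B -> distribution P (Y j) B = mu j B) /\
  independent_systems P (fun j => g_sigma_algebra_preimage (Y j)).

(* The sigma-algebra is the product one, generated by the coordinates. *)
Definition measurable_seq_fun (R : realType) (dX : measure_display)
    (X : measurableType dX) (f : (nat -> X) -> R) : Prop :=
  forall B : set R, measurable B ->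
    <<s [set C : set (nat -> X) | exists (t : nat) (D : set X),
           measurable D /\ C = [set x | D (x t)]] >> (f @^-1` B).

(* [law pb i q g] is D_i(q, g), and [quality pb i] is the set of values that
   the unknown quality of arm i may take: families such as the Bernoulli laws
   are not defined for every real q.
   [bias_unavoidable]: whatever the accuracy b < U_i, every estimate computed
   from an infinite sequence of samples of arm i misses the interval
   [q - b, q + b] with positive probability, for some possible quality q and
   some choice of the nuisance parameters. *)
Record pibai (R : realType) (k : nat) (Nu : Type) (dX : measure_display)
    (X : measurableType dX) := PIBAI {
  law : 'I_k -> R -> Nu -> probability X R ;
  quality : 'I_k -> set R ;
  bias : 'I_k -> R ;
  bias_ge0 : forall i, 0 <= bias i ;
  bias_unavoidable : forall (i : 'I_k) (b : R) (f : (nat -> X) -> R),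
    0 <= b < bias i -> measurable_seq_fun f ->
    exists (q : R) (g : nat -> Nu) (d : measure_display)
        (T : measurableType d) (P : probability T R) (Y : nat -> {RV P >-> X}),
      [/\ quality i q,
          independent_samples (fun t => law i q (g t)) Y
        & (P [set w | (f (fun t => Y t w) \in `[q - b, q + b])%R] < 1)%E]
}.

(* [n a e] is the number of samples used for accuracy a and failure
   probability e. *)
Record estimator (R : realType) (k : nat) (Nu : Type) (dX : measure_display)
    (X : measurableType dX) (pb : pibai R k Nu X) (n : R -> R -> nat) :=
  Estimator {
  estimate : 'I_k -> forall a e : R, (n a e).-tuple X -> R ;
  measurable_estimate : forall i a e,
    measurable_fun [set: (n a e).-tuple X] (@estimate i a e) ;
  estimateP : forall (i : 'I_k) (a e q : R) (g : 'I_(n a e) -> Nu)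
      (d : measure_display) (T : measurableType d) (P : probability T R)
      (Y : 'I_(n a e) -> {RV P >-> X}),
    0 < a -> 0 < e < 1 -> quality pb i q ->
    independent_samples (fun j => law pb i q (g j)) Y ->
    ((1 - e)%:E <=
      P [set w | (estimate i [tuple Y j w | j < n a e]
                    \in `[q - (bias pb i + a), q + (bias pb i + a)])%R])%E
}.

(* n a e = O(a^-2 log(1/e)) for (a, e) ranging over D. For integer-valued n
   the bound over all a > 0 and 0 < e < 1 (D = setT) forces n a e = 0 as soon
   as a^-2 log(1/e) is small enough; the asymptotic bound for small a and e is
   the case where D is a box around the origin. *)
Definition sample_size_bigO (R : realType) (D : set (R * R))
    (n : R -> R -> nat) : Prop :=
  exists C : R, forall a e : R, 0 < a -> 0 < e < 1 -> D (a, e) ->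
    (n a e)%:R <= C * (a ^- 2 * ln (e^-1)).

Inductive action (k : nat) := Sample of 'I_k | Output of 'I_k.
Arguments Sample {k}.
Arguments Output {k}.

(* A sequential algorithm maps a random seed in S and the past (arm, sample)
   pairs, oldest first, to its next action. *)
Record algorithm (k : nat) (dS dX : measure_display) (S : measurableType dS)
    (X : measurableType dX) := Algorithm {
  act :> S -> seq ('I_k * X) -> action k ;
  measurable_act : forall (m : nat) (s : m.-tuple 'I_k) (b : action k),
    measurable [set wx : S * m.-tuple X | act wx.1 (zip s wx.2) = b]
}.

(* [x (t, i)] is the sample received if arm i is chosen at iteration t; the
   history no longer grows once the algorithm has output an arm. *)
Fixpoint history (k : nat) (dS dX : measure_display) (S : measurableType dS)
    (X : measurableType dX) (A : algorithm k S X) (w : S)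
    (x : nat * 'I_k -> X) (t : nat) : seq ('I_k * X) :=
  if t is t'.+1 then
    let h := history A w x t' in
    if A w h is Sample i then rcons h (i, x (t', i)) else h
  else [::].

Definition stops_after (k : nat) (dS dX : measure_display)
    (S : measurableType dS) (X : measurableType dX) (A : algorithm k S X)
    (w : S) (x : nat * 'I_k -> X) (m : nat) (i : 'I_k) : Prop :=
  size (history A w x m) = m /\ A w (history A w x m) = Output i.

Definition sample_complexity (k : nat) (dS dX : measure_display)
    (S : measurableType dS) (X : measurableType dX) (A : algorithm k S X)
    (m : nat) : Prop :=
  forall (w : S) (x : nat * 'I_k -> X), exists i, stops_after A w x m i.

Definition effective_gap (R : realType) (k : nat) (Nu : Type)
    (dX : measure_display) (X : measurableType dX) (pb : pibai R k Nu X)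
    (p : 'I_k -> R) (istar i : 'I_k) : R :=
  (p istar - bias pb istar) - (p i + bias pb i).

Definition suboptimal (R : realType) (k : nat) (Nu : Type)
    (dX : measure_display) (X : measurableType dX) (pb : pibai R k Nu X)
    (p : 'I_k -> R) (istar : 'I_k) (a : R) (i : 'I_k) : Prop :=
  effective_gap pb p istar i <= a.

Definition admissible (R : realType) (k : nat) (Nu : Type)
    (dX : measure_display) (X : measurableType dX) (pb : pibai R k Nu X)
    (p : 'I_k -> R) (istar : 'I_k) : Prop :=
  [/\ forall i, quality pb i (p i),
      forall i, p i <= p istar
    & forall i, i != istar -> 0 < effective_gap pb p istar i].

(* The nuisance parameters (g t)_t are arbitrary and unknown to the algorithm.
   The seed W is independent of the samples. *)
Definition environment (R : realType) (k : nat) (Nu : Type)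
    (dX dS d : measure_display) (X : measurableType dX) (S : measurableType dS)
    (T : measurableType d) (pb : pibai R k Nu X) (p : 'I_k -> R)
    (g : nat -> Nu) (P : probability T R) (W : {RV P >-> S})
    (Y : nat * 'I_k -> {RV P >-> X}) : Prop :=
  (forall t i (B : set X), measurable B ->
     distribution P (Y (t, i)) B = law pb i (p i) (g t) B) /\
  independent_systems P (fun o : option (nat * 'I_k) =>
    if o is Some ti then g_sigma_algebra_preimage (Y ti)
    else g_sigma_algebra_preimage W).

Definition PAC (R : realType) (k : nat) (Nu : Type) (dX dS : measure_display)
    (X : measurableType dX) (S : measurableType dS) (pb : pibai R k Nu X)
    (A : algorithm k S X) (a e : R) : Prop :=
  forall (p : 'I_k -> R) (istar : 'I_k) (g : nat -> Nu) (d : measure_display)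
      (T : measurableType d) (P : probability T R) (W : {RV P >-> S})
      (Y : nat * 'I_k -> {RV P >-> X}),
    admissible pb p istar -> environment pb p g W Y ->
    ((1 - e)%:E <=
      P [set w | exists m i, stops_after A (W w) (fun ti => Y ti w) m i /\
                             suboptimal pb p istar a i])%E.

Definition samples_of (k : nat) (X : Type) (i : 'I_k) (h : seq ('I_k * X)) :
    seq X :=
  [seq z.2 | z <- h & z.1 == i].

(* The order s in which the arms are sampled and the rule that breaks ties in
   the arg max are left free. *)
Definition uniform_sampling (R : realType) (k : nat) (Nu : Type)
    (dX dS : measure_display) (X : measurableType dX) (S : measurableType dS)
    (pb : pibai R k Nu X) (n : R -> R -> nat) (E : estimator pb n)
    (a e : R) (A : algorithm k S X) : Prop :=
  let m := n (a / 2) (e / k%:R) in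
  exists s : (k * m).-tuple 'I_k,
    [/\ forall i, count_mem i s = m,
        forall (w : S) (h : seq ('I_k * X)) (t : 'I_(k * m)),
          unzip1 h = take t s -> A w h = Sample (tnth s t)
      & forall (w : S) (h : seq ('I_k * X)) (x : 'I_k -> m.-tuple X),
          unzip1 h = s -> (forall i, samples_of i h = x i) ->
          exists i, A w h = Output i /\
            forall j, estimate E j (x j) <= estimate E i (x i)].

(* Main.v *)
(** Since the sampling order is deterministic, the samples of a given arm form
    an independent subfamily, so by a union bound all [k] estimates are
    accurate with probability at least [1 - e]. On that event the output [i]
    satisfies
    [p i + bias i + a / 2 >= phat i >= phat istar
       >= p istar - bias istar - a / 2],
    that is, its effective gap is at most [a]. *)

Require Import Defs.
From HB Require Import structures.
From mathcomp Require Import all_boot all_order all_algebra.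
From mathcomp Require Import all_classical all_reals all_analysis.
From mathcomp Require Import ring lra.

Import Order.TTheory GRing.Theory Num.Theory.
Import numFieldNormedType.Exports.

Local Open Scope classical_set_scope.
Local Open Scope ring_scope.

(** Serves to pass from the independence of the whole environment to that of the samples of a single
    arm. *)
Lemma independent_systems_comp (R : realType) (d : measure_display)
    (T : measurableType d) (P : probability T R) (I J : eqType)
    (F : J -> set_system T) (f : I -> J) :
  injective f -> independent_systems P F -> independent_systems P (F \o f).
Proof.
move=> f_inj indF s B us FB.
(* This extends [B] along [f] without an inverse: by injectivity the fibre over [f i] is the
   singleton of [i], and outside the image of [f] the empty intersection is the whole space. *)
pose B' j := \bigcap_(i in [set i | f i = j]) B i.
have B'f i : B' (f i) = B i.
  apply/seteqP; split => [w|w Bw i' /= /f_inj -> //].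
  by apply.
have := indF (map f s) B'; rewrite map_inj_uniq// big_map => /(_ us).
under eq_bigr do rewrite B'f.
move=> <- => [|j /mapP[i si ->]]; last by rewrite B'f; exact: FB.
congr (P _); apply/seteqP; split => w Bw j /=.
  by move=> /mapP[i si ->]; rewrite B'f; exact: Bw.
by move=> sj; rewrite -B'f; apply: Bw; exact: map_f.
Qed.

(** Union bound on the complements, each of which has probability at most [c]. *)
Lemma probability_bigcap_ge (R : realType) (d : measure_display)
    (T : measurableType d) (P : probability T R) (I : finType)
    (G : I -> set T) (c : R) :
  (forall i, measurable (G i)) -> (forall i, ((1 - c)%:E <= P (G i))%E) ->
  ((1 - #|I|%:R * c)%:E <= P (\bigcap_i G i))%E.
Proof.
move=> mG PG.
have mGc i : measurable (~` G i) by exact: measurableC.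
have fI : finite_set [set: I] by exact: finite_finset.
have mcap : measurable (\bigcap_i G i).
  by rewrite -(setCK (\bigcap_i G i)) setC_bigcap; apply: measurableC;
    exact: fin_bigcup_measurable.
have PGc i : (P (~` G i) <= c%:E)%E.
  rewrite probability_setC//; move: (PG i).
  by rewrite -(fineK (fin_num_measure P _ (mG i))) -EFinB !lee_fin; lra.
have IE : [set` index_enum I] = [set: I].
  by apply/seteqP; split=> i //= _; exact: mem_index_enum.
have : (P (~` \bigcap_i G i) <= \sum_i P (~` G i))%E.
  rewrite fsbig_seq ?index_enum_uniq// IE; apply: content_sub_fsum => //.
    exact: measurableC.
  by rewrite setC_bigcap.
rewrite probability_setC// => /le_trans /(_ (lee_sum _ (fun i _ => PGc i))).
rewrite sumEFin sumr_const -[c *+ _]mulr_natl.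
rewrite -(fineK (fin_num_measure P _ mcap)) -EFinB !lee_fin; lra.
Qed.

(** [tau] enumerates in increasing order the positions of [i] in [s]. It is chosen before [x], so
    the times at which an arm is sampled do not depend on the samples received. *)
Lemma sampling_times (k N m : nat) (s : N.-tuple 'I_k) (i : 'I_k) :
  count_mem i s = m ->
  exists tau : 'I_m -> 'I_N,
    [/\ injective tau, forall j, tnth s (tau j) = i
      & forall (X : Type) (x : 'I_N -> X),
          samples_of i [seq (tnth s u, x u) | u <- enum 'I_N] =
          [seq x (tau j) | j <- enum 'I_m] ].
Proof.
move=> sm; pose l := [seq u <- enum 'I_N | tnth s u == i].
have szl : size l == m.
  by apply/eqP; rewrite size_filter -sm -[in RHS](map_tnth_enum s) [RHS]count_map.
pose t := Tuple szl; exists (tnth t); split.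
- by apply/tuple_uniqP; rewrite filter_uniq// enum_uniq.
- by move=> j; have := mem_tnth j t; rewrite mem_filter => /andP[/eqP].
- move=> X x; rewrite /samples_of filter_map -map_comp.
  rewrite [RHS](map_comp x (tnth t)) map_tnth_enum /=.
  by congr map.
Qed.

(** Induction on [t]: the arms recorded so far are [take t s], which is exactly what determines the
    next action. *)
Lemma history_uniform (k N : nat) (dS dX : measure_display)
    (S : measurableType dS) (X : measurableType dX) (A : algorithm k S X)
    (s : N.-tuple 'I_k) (w : S) (x : nat * 'I_k -> X) :
  (forall (h : seq ('I_k * X)) (t : 'I_N),
     unzip1 h = take t s -> A w h = Sample (tnth s t)) ->
  forall t, (t <= N)%N ->
    history A w x t =
    take t [seq (tnth s u, x (val u, tnth s u)) | u <- enum 'I_N].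
Proof.
move=> As; elim=> [|t IH] tN /=; first by rewrite take0.
rewrite (IH (ltnW tN)); set l := map _ _.
have szl : size l = N by rewrite size_map size_enum_ord.
rewrite (As _ (Ordinal tN)); last first.
  by rewrite /unzip1 map_take -map_comp -[in RHS](map_tnth_enum s).
rewrite (take_nth (tnth s (Ordinal tN), x (t, tnth s (Ordinal tN)))) ?szl//.
congr rcons; rewrite (nth_map (Ordinal tN)) ?size_enum_ord//.
by have -> : nth (Ordinal tN) (enum 'I_N) t = Ordinal tN
  by apply: val_inj; rewrite /= nth_enum_ord.
Qed.

Theorem theorem2 (R : realType) (n : R -> R -> nat) (D : set (R * R))
    (n_bigO : sample_size_bigO D n) :
  exists C : R,
  forall (k : nat) (Nu : Type) (dX dS : measure_display)
    (X : measurableType dX) (S : measurableType dS)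
    (pb : pibai R k Nu X) (E : estimator pb n)
    (a e : R) (A : algorithm k S X),
  (2 <= k)%N -> 0 < a -> 0 < e < 1 -> uniform_sampling E a e A ->
  PAC pb A a e /\
  exists N : nat,
    [/\ sample_complexity A N,
        N = (k * n (a / 2) (e / k%:R))%N
      & D (a / 2, e / k%:R) ->
          N%:R <= C * (k%:R / a ^+ 2 * ln (k%:R / e))].
Proof.
have [C0 C0P] := n_bigO.
(* The factor 4 comes from running the estimator with accuracy [a / 2], since [(a / 2) ^- 2] is four
   times [a ^- 2]. *)
exists (4 * C0) => k Nu dX dS X S pb E a e A k2 a0 /andP[e0 e1].
rewrite /uniform_sampling; set m := n _ _; set N := (k * m)%N.
move=> [s [s_count A_sample A_output]].
have k0 : (0 : R) < k%:R by rewrite ltr0n (ltn_trans _ k2).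
have a20 : 0 < a / 2 by rewrite divr_gt0.
have ek : 0 < e / k%:R < 1.
  rewrite divr_gt0//= ltr_pdivrMr// mul1r (lt_le_trans e1)// ler1n.
  exact: ltn_trans k2.
have /choice[tau tauP] : forall i, exists t : 'I_m -> 'I_N,
    [/\ injective t, forall j, tnth s (t j) = i
      & forall (X : Type) (x : 'I_N -> X),
          samples_of i [seq (tnth s u, x u) | u <- enum 'I_N] =
          [seq x (t j) | j <- enum 'I_m] ].
  by move=> i; exact: sampling_times.
(* The history after [N] iterations, which does not depend on the seed. *)
pose trace (x : nat * 'I_k -> X) :=
  [seq (tnth s u, x (val u, tnth s u)) | u <- enum 'I_N].
have size_trace x : size (trace x) = N by rewrite size_map size_enum_ord.
have historyN w x : history A w x N = trace x.
  rewrite (history_uniform _ N _ _ _ _ _ s)// => [|h t]; last exact: A_sample.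
  by rewrite take_oversize// size_trace.
pose xs (x : nat * 'I_k -> X) i : m.-tuple X :=
  [tuple x (val (tau i j), i) | j < m].
have outputP w x : exists i, A w (trace x) = Output i /\
    forall j, estimate E j (xs x j) <= estimate E i (xs x i).
  apply: A_output.
    by rewrite /trace /unzip1 -map_comp -[in RHS](map_tnth_enum s).
  move=> i; have [_ tau_s tauE] := tauP i.
  rewrite /trace (tauE _ (fun u => x (val u, tnth s u))).
  by apply: eq_map => j; rewrite tau_s.
have stopN w x i : A w (trace x) = Output i -> stops_after A w x N i.
  by move=> Ai; rewrite /stops_after historyN size_trace.
(* The success event quantifies over all stopping times, but only [N] is possible: before [N] the
   algorithm still samples, and after [N] the history keeps length [N], so its size is no longer
   [t]. *)
have stop_uniq w x t i : stops_after A w x t i -> A w (trace x) = Output i.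
  case=> szt At; have [tN|Nt|tN] := ltngtP t N; last by rewrite -(historyN w) -tN.
    have := A_sample w (history A w x t) (Ordinal tN).
    rewrite At => Asamp; suff /Asamp : unzip1 (history A w x t) = take t s by [].
    rewrite (history_uniform _ N _ _ _ _ _ s) ?(ltnW tN)//; last first.
      by move=> h u; exact: A_sample.
    by rewrite /unzip1 map_take -map_comp -[in RHS](map_tnth_enum s).
  have [j [Aj _]] := outputP w x.
  suff stuck u : history A w x (u + N) = trace x.
    move: szt; rewrite -(subnK (ltnW Nt)) stuck size_trace subnK ?(ltnW Nt)//.
    by move=> NE; rewrite NE ltnn in Nt.
  by elim: u => [|u IH] /=; rewrite ?historyN// IH Aj.
split; last first.
  exists N; split=> // [w x|Dae].
    by have [i [/stopN]] := outputP w x; exists i.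
  rewrite /N natrM; have := C0P _ _ a20 ek Dae; rewrite -/m => le_m.
  apply: (le_trans (ler_wpM2l (ltW k0) le_m)).
  rewrite invf_div le_eqVlt; apply/orP; left; apply/eqP; field.
  by rewrite gt_eqF.
move=> p istar g d T P W Y [qual p_max gap] [lawY indY].
pose G i := [set w | estimate E i (xs (fun ti => Y ti w) i)
  \in `[p i - (bias pb i + a / 2), p i + (bias pb i + a / 2)]].
have m_xs i : measurable_fun setT (fun w => xs (fun ti => Y ti w) i).
  apply/measurable_fun_tnthP => j.
  rewrite (_ : _ \o _ = Y (val (tau i j), i))//.
  by apply/funext => w /=; rewrite tnth_mktuple.
have mG i : measurable (G i).
  have m_est := measurableT_comp (@measurable_estimate _ _ _ _ _ _ _ E i
    (a / 2) (e / k%:R)) (m_xs i).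
  by rewrite -[G i]setTI; exact: (m_est measurableT _ (measurable_itv _)).
have PG i : ((1 - e / k%:R)%:E <= P (G i))%E.
  have [tau_inj _ _] := tauP i.
  apply: (@estimateP _ _ _ _ _ _ _ E i (a / 2) (e / k%:R) (p i)
    (fun j => g (tau i j)) _ _ P (fun j => Y (val (tau i j), i))) => //.
  split=> [j B mB|]; first exact: lawY.
  (* Sends the [j]-th sample of arm [i] to its index in the environment, where [None] stands for the
     seed. *)
  pose f (j : 'I_m) := Some (val (tau i j), i).
  have f_inj : injective f by move=> j j' [/val_inj/tau_inj].
  exact: (independent_systems_comp _ _ _ _ _ _ _ f f_inj indY).
have := probability_bigcap_ge _ _ _ P 'I_k G (e / k%:R) mG PG.
rewrite card_ord mulrCA divff ?gt_eqF// mulr1 => /le_trans; apply.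
(* [P] is only monotone on measurable sets, so the success event has to be
   rewritten as a finite union of measurable ones. *)
set Ev := [set w | _].
have m_tr : measurable_fun setT (fun w =>
    (W w, [tuple Y (val u, tnth s u) w | u < N])).
  apply: measurable_fun_pair => //; apply/measurable_fun_tnthP => u.
  rewrite (_ : _ \o _ = Y (val u, tnth s u))//.
  by apply/funext => w /=; rewrite tnth_mktuple.
have EvE : Ev = \bigcup_(i in [set i | suboptimal pb p istar a i])
    [set w | A (W w) (trace (fun ti => Y ti w)) = Output i].
  apply/seteqP; split=> w.
    by move=> [t [i [/stop_uniq Ai subi]]]; exists i.
  by move=> [i subi /stopN Ai]; exists N, i.
(* Puts the history in the form [zip s _] for which [measurable_act] gives measurability of the
   action, jointly in the seed and the samples. *)
have traceE w : trace (fun ti => Y ti w) =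
    zip s [tuple Y (val u, tnth s u) w | u < N].
  by rewrite -[in RHS](map_tnth_enum s) /= zip_map.
have mEv : measurable Ev.
  rewrite EvE; apply: fin_bigcup_measurable => [|i _]; first exact: finite_finset.
  under eq_fun do rewrite traceE.
  have := m_tr measurableT _ (measurable_act A s (Output i)).
  by rewrite setTI.
apply: le_measure; rewrite ?inE//.
  rewrite -(setCK (\bigcap_i G i)) setC_bigcap; apply: measurableC.
  apply: fin_bigcup_measurable => [|i _]; first exact: finite_finset.
  exact: measurableC.
move=> w Gw; rewrite EvE.
have [i [Ai max_i]] := outputP (W w) (fun ti => Y ti w).
exists i => //=; rewrite /suboptimal /effective_gap.
(* Only the upper end of the interval for [i] and the lower end of the one for [istar] enter; the
   two errors [a / 2] add up to [a]. *)
move: (Gw i I) (Gw istar I) (max_i istar).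
by rewrite /G /= !in_itv /= => /andP[_ +] /andP[+ _]; lra.
Qed.
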